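(* For all integers $\alpha\ge 0$ and $n\ge 0$, \[ \overline{p}_3(7\cdot 4^{\alpha+1}n)\equiv (-1)^n\,\overline{p}_3(7n)\pmod 7 \quad\text{and}\quad \overline{p}_3\big(4^{\alpha}(56n+49)\big)\equiv 0\pmod 7. \]
   Context: An overpartition of $n$ is a partition of $n$ in which the first occurrence of each distinct part may (or may not) be overlined. An overpartition triple of $n$ is a triple of overpartitions whose parts together sum to $n$. $\overline{p}_3(n)$ denotes the number of overpartition triples of $n$, with $\overline{p}_3(0)=1$; equivalently $\sum_{n\ge0}\overline{p}_3(n)q^n=\big((-q;q)_\infty/(q;q)_\infty\big)^3$, where $(a;q)_\infty=\prod_{n\ge0}(1-aq^n)$. *)

(* Defs.v *)
From mathcomp Require Import all_boot all_order all_algebra.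

Set Implicit Arguments.
Unset Strict Implicit.
Unset Printing Implicit Defensive.

(* An entry (k, b) is a part k, overlined when b = true. *)
Definition parts (s : seq (nat * bool)) : seq nat := unzip1 s.

Definition is_overpartition (s : seq (nat * bool)) : bool :=
  [&& sorted geq (parts s),
      all (fun k => 0 < k) (parts s)
    & all (fun i => nth false (unzip2 s) i ==>
                    (nth 0 (parts s) i \notin take i (parts s)))
          (iota 0 (size s))].

Definition weight (s : seq (nat * bool)) : nat := sumn (parts s).

(* Finite carrier for the sequences of at most n entries with parts at most n;
   overpartition_bounded shows that it misses no overpartition of weight <= n. *)
Definition bounded_seq (n : nat) := {bseq n of ('I_n.+1 * bool)%type}.

Definition entries (n : nat) (s : bounded_seq n) : seq (nat * bool) :=
  [seq (nat_of_ord x.1, x.2) | x <- s].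

Definition overpartition_triples (n : nat) :
    {set bounded_seq n * bounded_seq n * bounded_seq n} :=
  [set t | [&& is_overpartition (entries t.1.1),
               is_overpartition (entries t.1.2),
               is_overpartition (entries t.2)
             & weight (entries t.1.1) + weight (entries t.1.2)
               + weight (entries t.2) == n]].

Definition pbar3 (n : nat) : nat := #|overpartition_triples n|.

Lemma entries_inj (n : nat) : injective (@entries n).
Proof.
move=> s t; rewrite /entries => /inj_map H; apply: val_inj; apply: H.
by move=> [x b] [y c] /= [/val_inj -> ->].
Qed.

Lemma overpartition_bounded (n : nat) (s : seq (nat * bool)) :
  is_overpartition s -> weight s <= n -> exists t : bounded_seq n, entries t = s.
Proof.
case/and3P=> _ pos _; rewrite /weight => le_n.
have [sz le_k] : size s <= n /\ {in s, forall x, x.1 < n.+1}.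
  elim: s n pos le_n => [|[k b] s IHs] n //= /andP[k_gt0 pos] le_n.
  have le_s : sumn (parts s) <= n - k.
    by rewrite leq_subRL // (leq_trans _ le_n) ?leq_addr.
  have [sz le_k] := IHs _ pos le_s.
  have le_kn : k <= n by apply: leq_trans le_n; apply: leq_addr.
  split.
    have [sz1 _] := IHs _ pos (leqnn _).
    by apply: leq_trans le_n; rewrite -add1n leq_add.
  move=> x; rewrite inE => /predU1P[-> //|/le_k]; rewrite !ltnS => h.
  by apply: leq_trans h (leq_subr _ _).
have szt : size [seq (inord x.1 : 'I_n.+1, x.2) | x <- s] <= n by rewrite size_map.
exists (Bseq szt); rewrite /entries /= -map_comp -[RHS]map_id.
by apply/eq_in_map => -[k b] /le_k /= lt_k; rewrite inordK.
Qed.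

(* Main.v *)
(* Let theta = sum_(x in Z) (-1)^x q^(x^2).  The generating function of
   overpartitions is 1 / theta (Gauss), so modulo 7 that of overpartition
   triples is theta^4 / theta^7 = theta^4 / theta(q^7).  Extracting the exponents
   divisible by 7 and using r4(7n) = r4(n) mod 7, the numerator becomes theta^4
   again, whence pbar3(7n) = (-1)^n r3(n) mod 7, where r3 and r4 count the
   representations as sums of 3 and 4 squares.  The theorem then follows from
   r3(4n) = r3(n) and r3(8n + 7) = 0.

   The congruence for r4 comes from the 8 integral quaternions
   a = 2 +- i +- j +- k of norm 7: if 7 divides the norm of x, then 7 divides
   conj(a) x for exactly one a, or for all 8 of them when 7 divides x.  Counting
   the products a y with y of norm n gives 8 r4(n) = r4(7n) mod 7. *)

Require Import Defs.
From mathcomp Require Import all_boot all_order all_algebra.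
From mathcomp Require Import ring zify.

Set Implicit Arguments.
Unset Strict Implicit.
Unset Printing Implicit Defensive.
Import Order.TTheory GRing.Theory Num.Theory.

(** * Overpartitions with bounded parts *)

(** A mark in [s] asks that its part differ from [k] and be new within [s]; taken together, the
    first demands say that [(k, true)] does not occur in [s]. *)
Lemma is_overpartition_cons k b s :
  is_overpartition ((k, b) :: s) =
  [&& 0 < k, all (fun j => j <= k) (parts s), (k, true) \notin s
    & is_overpartition s].
Proof.
rewrite /is_overpartition /= -/(parts s) implybT /=.
rewrite path_sortedE; last by move=> ? ? ? /[swap]; apply: leq_trans.
rewrite (iotaDl 1 0) all_map.
rewrite (@eq_all _ (preim _ _) (predI
   (fun i => nth false (unzip2 s) i ==> (nth 0 (parts s) i != k))
   (fun i => nth false (unzip2 s) i ==>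
             (nth 0 (parts s) i \notin take i (parts s))))).
  rewrite all_predI /=; set A := all _ (iota _ _).
  have -> : A = ((k, true) \notin s); last first.
    by rewrite -!andbA; do !bool_congr.
  rewrite /A.
  apply/allP/idP => [H|kNs i].
    apply/negP => ks; have := ks; rewrite -index_mem => lt_i.
    have := H (index (k, true) s); rewrite mem_iota => /(_ lt_i).
    by rewrite !(nth_map (0, false)) // nth_index //= eqxx.
  rewrite mem_iota /= add0n => lt_i.
  rewrite !(nth_map (0, false)) //; apply/implyP; apply: contraL.
  move/eqP=> ki; apply: contra kNs => bi.
  apply/(nthP (0, false)); exists i => //.
  by move: ki bi; case: (nth _ _ _) => ? [] //= ->.
by move=> i /=; rewrite inE negb_or; case: (nth false _ _).
Qed.

Definition overpartitions N : seq (seq (nat * bool)) :=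
  [seq s <- [seq entries t | t <- enum {: bounded_seq N}]
     | is_overpartition s & weight s <= N].

Lemma mem_overpartitions N s :
  (s \in overpartitions N) = is_overpartition s && (weight s <= N).
Proof.
rewrite mem_filter.
case: (boolP (is_overpartition s && _)) => //= /andP[ov_s le_sN].
have [t <-] := overpartition_bounded ov_s le_sN.
by apply: map_f; rewrite mem_enum.
Qed.

Lemma overpartitions_uniq N : uniq (overpartitions N).
Proof.
by rewrite filter_uniq // map_inj_uniq ?enum_uniq //; apply: entries_inj.
Qed.

Definition parts_le m (s : seq (nat * bool)) := all (fun k => k <= m) (parts s).
(** This class splits the factor (1 + q^m) / (1 - q^m) in two: a leading overlined m accounts for
    the numerator, the plain copies of m for the denominator. *)
Definition parts_le_nomark m s := parts_le m s && ((m, true) \notin s).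

(** A polynomial that agrees with the full generating series up to degree [N], whence the product
    identities modulo q^(N+1) below. *)
Definition gf (R : nzRingType) N (Q : pred (seq (nat * bool))) : {poly R} :=
  (\sum_(s <- overpartitions N | Q s) 'X^(weight s))%R.

Definition num_ov N (Q : pred (seq (nat * bool))) i :=
  size [seq s <- overpartitions N | Q s & weight s == i].

Lemma coef_gf (R : nzRingType) N Q i :
  ((gf R N Q)`_i = (num_ov N Q i)%:R)%R.
Proof.
rewrite /gf /num_ov size_filter coef_sum -sum1_count natr_sum.
rewrite [RHS]big_mkcondr /=.
by apply: eq_bigr => s _; rewrite coefXn eq_sym; case: eqP.
Qed.

Lemma mem_num_ov N (Q : pred (seq (nat * bool))) i s : i <= N ->
  (s \in [seq s <- overpartitions N | Q s & weight s == i]) =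
  [&& Q s, weight s == i & is_overpartition s].
Proof.
move=> le_iN; rewrite mem_filter mem_overpartitions -andbA; case: (Q s) => //=.
by case: eqP => //= ->; rewrite le_iN andbT.
Qed.

(** Prefixing [(k, b)] is a bijection from the overpartitions in [Q2] to those in [Q] but not in
    [Q1], and it raises the weight by [k]. The test [k <= i] guards the truncated subtraction. *)
Lemma num_ov_split_head N (Q Q1 Q2 : pred (seq (nat * bool))) k b i :
  i <= N -> 0 < k ->
  (forall s, is_overpartition s ->
     Q s = Q1 s || (if s is x :: s' then (x == (k, b)) && Q2 s' else false)) ->
  (forall s, is_overpartition ((k, b) :: s) -> ~~ Q1 ((k, b) :: s)) ->
  (forall s, is_overpartition s -> Q2 s -> is_overpartition ((k, b) :: s)) ->
  num_ov N Q i = num_ov N Q1 i + (if k <= i then num_ov N Q2 (i - k) else 0).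
Proof.
move=> le_iN k_gt0 QE Q1N Q2ov.
pose l2 := [seq (k, b) :: s | s <- if k <= i then
  [seq s <- overpartitions N | Q2 s & weight s == i - k] else [::]].
rewrite -(_ : size l2 = if k <= i then num_ov N Q2 (i - k) else 0); last first.
  by rewrite size_map; case: ifP.
rewrite /num_ov -size_cat; apply/perm_size/uniq_perm.
- by rewrite filter_uniq ?overpartitions_uniq.
- rewrite cat_uniq filter_uniq ?overpartitions_uniq //=; apply/andP; split.
    apply/hasPn => _ /mapP[s s_in ->]; rewrite mem_num_ov //; apply/negP.
    by case/and3P=> Q1s _ ov; move: (Q1N _ ov); rewrite Q1s.
  rewrite map_inj_uniq; last by move=> ? ? [].
  by case: ifP => // _; rewrite filter_uniq ?overpartitions_uniq.
move=> s; rewrite mem_cat !mem_num_ov //.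
have -> : (s \in l2) = if s is x :: s' then
    [&& x == (k, b), Q2 s', weight s == i & is_overpartition s] else false.
  apply/mapP/idP => [[s']|].
    case: ifP => // le_ki.
    rewrite mem_num_ov; last by apply: leq_trans le_iN; apply: leq_subr.
    case/and3P=> Q2s /eqP ws ov -> /=; rewrite eqxx Q2s Q2ov // andbT /=.
    by rewrite /weight /= -/(weight s') ws subnKC.
  case: s => // x s /and4P[/eqP-> Q2s /eqP ws ov]; exists s => //.
  have wsE : k + weight s = i by rewrite -ws.
  rewrite -wsE leq_addr addKn mem_num_ov; last first.
    by apply: leq_trans le_iN; rewrite -wsE leq_addl.
  by rewrite Q2s eqxx; move: ov; rewrite is_overpartition_cons => /and4P[].
case ov: (is_overpartition s); last first.
  by rewrite !andbF; case: s {ov} => // ? ?; rewrite !andbF.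
rewrite QE //; case: s ov => [|x s] ov /=; first by rewrite !orbF.
by rewrite ?andbT andb_orl -?andbA.
Qed.

Lemma num_ov_parts_le N m i : i <= N -> 0 < m ->
  num_ov N (parts_le m) i =
  num_ov N (parts_le_nomark m) i
  + (if m <= i then num_ov N (parts_le_nomark m) (i - m) else 0).
Proof.
move=> le_iN m_gt0; apply: (num_ov_split_head (b := true)) => //.
- case=> [//|[k b] s].
  rewrite is_overpartition_cons => /and4P[k_gt0 le_k kNs ov].
  rewrite /parts_le_nomark /parts_le /= inE xpair_eqE negb_or.
  rewrite -/(parts_le _ _).
  case: (ltngtP k m) => km /=.
  + case: (boolP ((m, true) \in s)) => [ms|_].
      have/allP/(_ m) := le_k; rewrite (map_f fst ms) leqNgt km.
      by move/(_ isT).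
    by rewrite andbT xpair_eqE (ltn_eqF km) orbF.
  + by rewrite xpair_eqE (gtn_eqF km).
  + by rewrite xpair_eqE -km eqxx kNs /parts_le le_k; case: b.
- by move=> s _; rewrite /parts_le_nomark negb_and negbK inE eqxx orbT.
- move=> s ov /andP[le_s Ns].
  by rewrite is_overpartition_cons m_gt0 ov Ns !andbT.
Qed.

Lemma num_ov_parts_le_nomark N m i : i <= N ->
  num_ov N (parts_le_nomark m.+1) i =
  num_ov N (parts_le m) i
  + (if m < i then num_ov N (parts_le_nomark m.+1) (i - m.+1) else 0).
Proof.
move=> le_iN; apply: (num_ov_split_head (b := false)) => //.
- case=> [//|[k b] s].
  rewrite is_overpartition_cons => /and4P[k_gt0 le_k kNs ov].
  rewrite /parts_le_nomark /parts_le /= inE negb_or !xpair_eqE.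
  case: (ltngtP k m.+1) => km /=.
  + have lt_s : {in parts s, forall j, j < m.+1}.
      by move=> j /(allP le_k) => jk; apply: leq_ltn_trans km.
    rewrite -ltnS km /= orbF.
    have -> : all (fun j => j <= m) (parts s) by apply/allP => j /lt_s.
    have -> : all (fun j => j <= m.+1) (parts s) by apply/allP => j /lt_s /ltnW.
    by apply/negP => /(map_f fst) /lt_s; rewrite ltnn.
  + by rewrite leqNgt (ltn_trans _ km).
  + by rewrite km ltnn -km kNs le_k; case: b.
- by move=> s _; rewrite /parts_le /= ltnn.
- by move=> s ov /andP[le_s Ns]; rewrite is_overpartition_cons ov Ns !andbT.
Qed.

Local Open Scope ring_scope.

(** * Sums of three and four squares *)

(** Listing k and -k side by side lets [thetaS] peel off two equal terms at once. *)
Fixpoint box (n : nat) : seq int :=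
  if n is m.+1 then [:: m.+1%:Z, - m.+1%:Z & box m] else [:: 0].

Lemma mem_box n x : (x \in box n) = (`|x| <= n)%N.
Proof.
elim: n x => [|n IHn] x /=; first by rewrite inE; lia.
by rewrite !inE IHn; lia.
Qed.

Lemma box_uniq n : uniq (box n).
Proof. by elim: n => //= n IHn; rewrite inE !mem_box IHn; lia. Qed.

Definition norm3 (v : int * int * int) : nat :=
  (`|v.1.1| ^ 2 + `|v.1.2| ^ 2 + `|v.2| ^ 2)%N.
Definition norm4 (v : int * int * int * int) : nat :=
  (norm3 v.1 + `|v.2| ^ 2)%N.

Definition box3 N : seq (int * int * int) :=
  [seq (xy, z) | xy <- [seq (x, y) | x <- box N, y <- box N], z <- box N].
Definition box4 N : seq (int * int * int * int) :=
  [seq (v, w) | v <- box3 N, w <- box N].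
Definition sols3 N m := [seq v <- box3 N | norm3 v == m].
Definition sols4 N m := [seq v <- box4 N | norm4 v == m].

Lemma box3_uniq N : uniq (box3 N).
Proof.
by rewrite !allpairs_uniq ?box_uniq //; move=> [? ?] [? ?] _ _ [-> ->].
Qed.

Lemma box4_uniq N : uniq (box4 N).
Proof.
rewrite allpairs_uniq ?box_uniq ?box3_uniq //.
by move=> [? ?] [? ?] _ _ [-> ->].
Qed.

Lemma sols3_uniq N m : uniq (sols3 N m).
Proof. by rewrite filter_uniq ?box3_uniq. Qed.
Lemma sols4_uniq N m : uniq (sols4 N m).
Proof. by rewrite filter_uniq ?box4_uniq. Qed.

(** The box misses no solution, because |x| <= x^2 <= m for each coordinate. *)
Lemma mem_sols3 N m v : (m <= N)%N -> (v \in sols3 N m) = (norm3 v == m).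
Proof.
move=> le_mN; rewrite mem_filter; case: eqP => //=; case: v => [[x y] z].
rewrite /norm3 /= => vm; rewrite !allpairs_f ?mem_box //; nia.
Qed.

Lemma mem_sols4 N m v : (m <= N)%N -> (v \in sols4 N m) = (norm4 v == m).
Proof.
move=> le_mN; rewrite mem_filter; case: eqP => //=; case: v => [[[x y] z] w].
rewrite /norm4 /norm3 /= => vm; rewrite !allpairs_f ?mem_box //; nia.
Qed.

Definition r3 m := size (sols3 m m).
Definition r4 m := size (sols4 m m).

Lemma size_sols3 N m : (m <= N)%N -> size (sols3 N m) = r3 m.
Proof.
move=> le_mN; apply/perm_size/uniq_perm; rewrite ?sols3_uniq // => v.
by rewrite !mem_sols3.
Qed.

Lemma size_sols4 N m : (m <= N)%N -> size (sols4 N m) = r4 m.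
Proof.
move=> le_mN; apply/perm_size/uniq_perm; rewrite ?sols4_uniq // => v.
by rewrite !mem_sols4.
Qed.

Lemma norm3Z v : (norm3 v)%:Z = v.1.1 ^+ 2 + v.1.2 ^+ 2 + v.2 ^+ 2.
Proof. by rewrite /norm3 !PoszD -!abszX !abszE !ger0_norm ?sqr_ge0. Qed.

Lemma norm4Z v :
  (norm4 v)%:Z = v.1.1.1 ^+ 2 + v.1.1.2 ^+ 2 + v.1.2 ^+ 2 + v.2 ^+ 2.
Proof. by rewrite /norm4 PoszD norm3Z -!abszX !abszE ger0_norm ?sqr_ge0. Qed.

(** Squares are 0 or 1 modulo 4, so three squares with sum divisible by 4 are all even, and doubling
    is a bijection between the solution sets. *)
Lemma r3_mul4 n : r3 (4 * n) = r3 n.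
Proof.
pose dbl (v : int * int * int) := (2 * v.1.1, 2 * v.1.2, 2 * v.2).
have dbl_inj : injective dbl.
  by move=> [[x y] z] [[x' y'] z'] [ex ey ez]; congr (_, _, _); lia.
rewrite /r3 -(size_map dbl (sols3 n n)); apply/perm_size/uniq_perm.
- exact: sols3_uniq.
- by rewrite map_inj_uniq ?sols3_uniq.
move=> v; rewrite mem_sols3 //; apply/eqP/mapP => [|[u]]; last first.
  rewrite mem_sols3 // => /eqP <- ->; apply/eqP; rewrite -eqz_nat.
  by rewrite PoszM !norm3Z /=; apply/eqP; ring.
move=> /(congr1 Posz); rewrite norm3Z; case: v => [[x y] z] /= vE.
have halve (t : int) : exists a, exists b : bool, t = 2 * a + b%:Z.
  by exists (t %/ 2)%Z, (t %% 2 != 0)%Z; lia.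
have [x' [b xE]] := halve x; have [y' [c yE]] := halve y.
have [z' [d zE]] := halve z; subst x y z.
have [b0 [c0 d0]] : b = false /\ c = false /\ d = false.
  by move: b c d vE => [] [] [] vE; do ?split => //; exfalso; lia.
exists (x', y', z'); last by rewrite /dbl b0 c0 d0 !addr0.
rewrite mem_sols3 // -eqz_nat norm3Z /=; apply/eqP.
by move: vE; rewrite b0 c0 d0 !addr0 PoszM; lia.
Qed.

(** Squares are 0, 1 or 4 modulo 8, and no three of these add up to 7 modulo 8. *)
Lemma r3_8D7 n : r3 (8 * n + 7) = 0%N.
Proof.
apply/eqP; rewrite -leqn0 leqNgt -has_predT; apply/hasPn.
move=> [[x y] z]; rewrite mem_sols3 // => /eqP/(congr1 Posz).
rewrite norm3Z /= => vE.
have mod4 (t : int) : exists a (r : int),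
    t = 4 * a + r /\ [|| r == 0, r == 1, r == 2 | r == 3].
  by exists (t %/ 4)%Z, (t %% 4)%Z; lia.
have sq8 (t : int) : exists a,
    [\/ t ^+ 2 = 8 * a, t ^+ 2 = 8 * a + 1 | t ^+ 2 = 8 * a + 4].
  have [a [r [-> /or4P[] /eqP->]]] := mod4 t.
  - by exists (2 * a ^+ 2); constructor 1; ring.
  - by exists (2 * a ^+ 2 + a); constructor 2; ring.
  - by exists (2 * a ^+ 2 + 2 * a); constructor 3; ring.
  - by exists (2 * a ^+ 2 + 3 * a + 1); constructor 2; ring.
have [a Ha] := sq8 x; have [b Hb] := sq8 y; have [c Hc] := sq8 z.
by move: vE; case: Ha => ->; case: Hb => ->; case: Hc => ->; lia.
Qed.

(* (x0, x1, x2, x3) stands for x0 + x1 i + x2 j + x3 k, and conj_mul a x for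
   the product of the conjugate of a with x. *)
Definition conj_mul (a x : int * int * int * int) : int * int * int * int :=
  let: (a0, a1, a2, a3) := a in let: (x0, x1, x2, x3) := x in
  (a0 * x0 + a1 * x1 + a2 * x2 + a3 * x3,
   a0 * x1 - a1 * x0 - a2 * x3 + a3 * x2,
   a0 * x2 + a1 * x3 - a2 * x0 - a3 * x1,
   a0 * x3 - a1 * x2 + a2 * x1 - a3 * x0).

(** [conj_mul] at the conjugate of [a], hence the ordinary product a x. *)
Definition mulq (a x : int * int * int * int) : int * int * int * int :=
  let: (a0, a1, a2, a3) := a in conj_mul (a0, - a1, - a2, - a3) x.

Definition scaleq (k : int) (x : int * int * int * int) :=
  (k * x.1.1.1, k * x.1.1.2, k * x.1.2, k * x.2).

Definition dvdq (d : int) (x : int * int * int * int) :=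
  [&& (d %| x.1.1.1)%Z, (d %| x.1.1.2)%Z, (d %| x.1.2)%Z & (d %| x.2)%Z].

Lemma conj_mulK a x : conj_mul a (mulq a x) = scaleq (norm4 a) x.
Proof.
rewrite /scaleq norm4Z; case: a x => [[[a0 a1] a2] a3] [[[x0 x1] x2] x3] /=.
by congr (_, _, _, _); ring.
Qed.

Lemma mulqK a x : mulq a (conj_mul a x) = scaleq (norm4 a) x.
Proof.
rewrite /scaleq norm4Z; case: a x => [[[a0 a1] a2] a3] [[[x0 x1] x2] x3] /=.
by congr (_, _, _, _); ring.
Qed.

Lemma mulq_scale a k x : mulq a (scaleq k x) = scaleq k (mulq a x).
Proof.
rewrite /scaleq; case: a x => [[[a0 a1] a2] a3] [[[x0 x1] x2] x3] /=.
by congr (_, _, _, _); ring.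
Qed.

Lemma scaleq_inj k : k != 0 -> injective (scaleq k).
Proof.
move=> k0 [[[x0 x1] x2] x3] [[[y0 y1] y2] y3] [].
by do 4!move/(mulfI k0) => ->.
Qed.

Lemma norm4_mulq a x : norm4 (mulq a x) = (norm4 a * norm4 x)%N.
Proof.
apply/eqP; rewrite -eqz_nat PoszM !norm4Z.
by case: a x => [[[a0 a1] a2] a3] [[[x0 x1] x2] x3] /=; apply/eqP; ring.
Qed.

Lemma dvdqP d x : reflect (exists y, x = scaleq d y) (dvdq d x).
Proof.
case: x => [[[x0 x1] x2] x3]; apply: (iffP and4P) => /= [[]|[y [-> -> -> ->]]].
  do 4!move=> /dvdzP[? ->].
  by eexists (_, _, _, _); rewrite /scaleq /=; congr (_, _, _, _); exact: mulrC.
by rewrite !dvdz_mulr.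
Qed.

(** * Quaternions of norm 7 and r4 modulo 7 *)

Definition quats7 : seq (int * int * int * int) :=
  [seq (v, w) | v <- [seq (u, z) | u <- [seq (2 : int, y) | y <- [:: 1; -1]],
     z <- [:: 1; -1]], w <- [:: 1; -1]].

Lemma norm_quats7 : all (fun a => norm4 a == 7) quats7.
Proof. by vm_compute. Qed.

Definition modq (d : int) (x : int * int * int * int) :=
  ((x.1.1.1 %% d)%Z, (x.1.1.2 %% d)%Z, (x.1.2 %% d)%Z, (x.2 %% d)%Z).

Lemma modqE d x : exists k, x = modq d x + scaleq d k.
Proof.
exists ((x.1.1.1 %/ d)%Z, (x.1.1.2 %/ d)%Z, (x.1.2 %/ d)%Z, (x.2 %/ d)%Z).
case: x => [[[x0 x1] x2] x3]; rewrite /scaleq /modq /=.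
by congr (_, _, _, _); rewrite /= addrC mulrC -divz_eq.
Qed.

Lemma dvdz_addMl (d k u v : int) : v = u + d * k -> (d %| v)%Z = (d %| u)%Z.
Proof. by move=> ->; rewrite rpredDr // dvdz_mulr. Qed.

(** By linearity of x -> conj(a) x only the residues of x matter, which reduces [count_quats7] to a
    finite check. *)
Lemma dvdq_conj_mul_modq d a x :
  dvdq d (conj_mul a (modq d x)) = dvdq d (conj_mul a x).
Proof.
have [k {2}->] := modqE d x.
case: a (modq d x) k => [[[a0 a1] a2] a3] [[[x0 x1] x2] x3] [[[k0 k1] k2] k3].
rewrite /dvdq /=; symmetry; congr [&& _, _, _ & _].
(* The four multipliers are the coordinates of conj(a) k. *)
- by apply: (@dvdz_addMl _ (a0 * k0 + a1 * k1 + a2 * k2 + a3 * k3)); ring.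
- by apply: (@dvdz_addMl _ (a0 * k1 - a1 * k0 - a2 * k3 + a3 * k2)); ring.
- by apply: (@dvdz_addMl _ (a0 * k2 + a1 * k3 - a2 * k0 - a3 * k1)); ring.
- by apply: (@dvdz_addMl _ (a0 * k3 - a1 * k2 + a2 * k1 - a3 * k0)); ring.
Qed.

Lemma dvdn_norm4_modq (d : nat) x :
  (d %| norm4 (modq d x))%N = (d %| norm4 x)%N.
Proof.
have dvdE m : (d %| m)%N = (d %| m%:Z)%Z by []; rewrite !dvdE.
have [k {2}->] := modqE d x; rewrite !norm4Z.
case: (modq d x) k => [[[x0 x1] x2] x3] [[[k0 k1] k2] k3] /=; symmetry.
(* Expand norm(x + d k) = norm(x) + d (2 x.k + d norm(k)). *)
refine (@dvdz_addMl d%:Z (2 * (x0 * k0 + x1 * k1 + x2 * k2 + x3 * k3)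
   + d%:Z * (k0 ^+ 2 + k1 ^+ 2 + k2 ^+ 2 + k3 ^+ 2)) _ _ _); ring.
Qed.

Definition residues : seq int := [seq Posz i | i <- iota 0 7].

(** Working modulo 7 treats the two possible counts, 1 and 8, alike. *)
Lemma count_quats7_residues :
  all (fun x => all (fun y => all (fun z => all (fun w =>
    (7 %| norm4 (x, y, z, w))%N ==>
    (count (fun a => dvdq 7 (conj_mul a (x, y, z, w))) quats7 %% 7 == 1)%N)
    residues) residues) residues) residues.
Proof. by vm_compute. Qed.

Lemma count_quats7 x : (7 %| norm4 x)%N ->
  (count (fun a => dvdq 7 (conj_mul a x)) quats7 = 1 %[mod 7])%N.
Proof.
have mem7 (t : int) : (t %% 7)%Z \in residues.
  by apply/mapP; exists (`|(t %% 7)%Z|)%N; rewrite ?mem_iota; lia.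
rewrite -dvdn_norm4_modq => dvd_x.
under eq_count do rewrite -dvdq_conj_mul_modq.
apply/eqP; have /allP/(_ _ (mem7 x.1.1.1)) := count_quats7_residues.
move=> /allP/(_ _ (mem7 x.1.1.2))/allP/(_ _ (mem7 x.1.2))/allP/(_ _ (mem7 x.2)).
by move/implyP; apply.
Qed.

(** Since a conj(a) = conj(a) a = 7, the map x -> conj(a) x / 7 inverts y -> a y. *)
Lemma sols4_mulq a n : norm4 a = 7%N ->
  perm_eq [seq mulq a x | x <- sols4 n n]
    [seq x <- sols4 (7 * n) (7 * n) | dvdq 7 (conj_mul a x)].
Proof.
move=> a7; apply: uniq_perm.
- rewrite map_inj_uniq ?sols4_uniq // => x y /(congr1 (conj_mul a)).
  by rewrite !conj_mulK a7; apply: scaleq_inj.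
- by rewrite filter_uniq ?sols4_uniq.
move=> x; rewrite mem_filter mem_sols4 //; apply/mapP/idP => [[y]|].
  rewrite mem_sols4 // => /eqP yn ->; rewrite norm4_mulq a7 yn eqxx andbT.
  by rewrite conj_mulK a7; apply/dvdqP; exists y.
case/andP=> /dvdqP[y yE] /eqP xn; have xy : x = mulq a y.
  by apply: (@scaleq_inj 7) => //; rewrite -mulq_scale -yE mulqK a7 //.
exists y => //; rewrite mem_sols4 //.
by move: xn; rewrite xy norm4_mulq a7; lia.
Qed.

(** Double counting of the pairs (a, x) with norm(x) = 7n and 7 dividing conj(a) x: each a
    contributes r4(n), each x contributes 1 modulo 7. *)
Lemma r4_mul7 n : (r4 (7 * n) = r4 n %[mod 7])%N.
Proof.
have H : (\sum_(a <- quats7) r4 n =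
   \sum_(x <- sols4 (7 * n) (7 * n))
     count (fun a => dvdq 7 (conj_mul a x)) quats7)%N.
  under [RHS]eq_bigr do rewrite -sum1_count big_mkcond.
  rewrite exchange_big /=; apply: eq_big_seq => a /(allP norm_quats7)/eqP a7.
  rewrite -big_mkcond sum1_count -size_filter -(perm_size (sols4_mulq n a7)).
  by rewrite size_map.
have : (8 * r4 n = r4 (7 * n) %[mod 7])%N.
  have -> : (8 * r4 n = \sum_(a <- quats7) r4 n)%N.
    by rewrite big_const_seq iter_addn_0 mulnC.
  rewrite H [in RHS]/r4 -sum1_size -modn_summ -[in RHS]modn_summ.
  congr (_ %% _)%N; apply: eq_big_seq => x; rewrite mem_sols4 // => /eqP xn.
  by apply: count_quats7; rewrite xn dvdn_mulr.
by move=> <-; lia.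
Qed.

(** * Gauss' identity for theta *)

(** Divisibility of a difference by X^N expresses equality of power series below degree N. *)
Lemma dvdXnP (F : fieldType) (N : nat) (p : {poly F}) :
  reflect (forall i, (i < N)%N -> p`_i = 0) ('X^N %| p).
Proof.
apply: (iffP idP) => [/dvdpP[q ->] i lt_iN|p0]; first by rewrite coefMXn lt_iN.
rewrite -(poly_take_drop N p) (_ : take_poly N p = 0) ?add0r ?dvdp_mull //.
by apply/polyP => i; rewrite coef_take_poly coef0; case: ifP => // /p0.
Qed.

(** A nonzero constant term makes [p] coprime to X; this replaces inverting [p] as a power
    series. *)
Lemma dvdXn_mulIl (F : fieldType) (N : nat) (p q : {poly F}) :
  p`_0 != 0 -> 'X^N %| p * q -> 'X^N %| q.
Proof.
move=> p0; rewrite Gauss_dvdpr //; apply: coprimep_expl.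
by rewrite coprimep_sym coprimepX -horner_coef0 in p0 *.
Qed.

Definition theta (R : nzRingType) (n : nat) : {poly R} :=
  \sum_(x <- box n) (-1) ^+ `|x|%N * 'X^(`|x| ^ 2)%N.

Lemma thetaS (R : nzRingType) n :
  theta R n.+1 = theta R n + 2 * (-1) ^+ n.+1 * 'X^(n.+1 ^ 2)%N.
Proof.
rewrite /theta /= !big_cons abszN !absz_nat addrA -mulr2n addrC.
by rewrite -mulrA mulr_natl.
Qed.

Lemma theta_coef0 (R : nzRingType) n : (theta R n)`_0 = 1.
Proof.
elim: n => [|n IHn]; first by rewrite /theta big_seq1 mul1r coefXn.
by rewrite thetaS coefD IHn coefMXn expn_gt0 addr0.
Qed.

(* After Shanks' proofs of Euler's and Gauss' identities: theta * prod_plus is a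
   finite sum whose term of index 0 is prod_minus, and whose other terms are
   divisible by q^(n+1). *)
Section Shanks.

Variable R : comNzRingType.
Implicit Types n s m : nat.

Definition prod_minus s n : {poly R} := \prod_(s.+1 <= j < n.+1) (1 - 'X^j).
Definition prod_plus n : {poly R} := \prod_(1 <= j < n.+1) (1 + 'X^j).

Definition shanks n s : {poly R} :=
  if s is t.+1 then
    2 * (-1) ^+ s * 'X^(s * n.+1)%N * prod_minus s n * prod_plus t
  else prod_minus 0 n.

Lemma prod_minusS s n : (s <= n)%N ->
  prod_minus s n.+1 = prod_minus s n * (1 - 'X^(n.+1)).
Proof. by move=> le_sn; rewrite /prod_minus big_nat_recr. Qed.

Lemma prod_minus_rec s n : (s < n)%N ->
  prod_minus s n = (1 - 'X^(s.+1)) * prod_minus s.+1 n.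
Proof. by move=> lt_sn; rewrite /prod_minus big_ltn. Qed.

Lemma prod_plusS n : prod_plus n.+1 = prod_plus n * (1 + 'X^(n.+1)).
Proof. by rewrite /prod_plus big_nat_recr. Qed.

(** This is the induction step of [theta_shanks] in closed form for every partial sum, which makes
    it provable by induction on [m]. *)
Lemma shanks_telescope n m : (m <= n)%N ->
  \sum_(s < m.+1) (shanks n.+1 s - (1 + 'X^(n.+1)) * shanks n s) =
  2 * (-1) ^+ m.+1 * 'X^(m.+1 * n.+1)%N * prod_minus m n * prod_plus m.
Proof.
elim: m => [|m IHm] le_mn.
  rewrite big_ord1 /= prod_minusS // /prod_plus big_geq // mul1n.
  by rewrite expr1; ring.
rewrite big_ord_recr /= IHm 1?ltnW // prod_minusS //= (prod_minus_rec le_mn).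
rewrite prod_plusS.
have -> : (m.+1 * n.+2 = m.+1 * n.+1 + m.+1)%N by lia.
have -> : (m.+2 * n.+1 = m.+1 * n.+1 + n.+1)%N by lia.
rewrite !exprD !(exprS (-1)); ring.
Qed.

Lemma theta_shanks n : theta R n * prod_plus n = \sum_(s < n.+1) shanks n s.
Proof.
elim: n => [|n IHn].
  rewrite big_ord1 /theta big_seq1 /= /prod_plus /prod_minus.
  by rewrite !big_geq //= !mulr1.
have := shanks_telescope (leqnn n); rewrite sumrB -mulr_sumr -IHn => /eqP.
(* The remainder 2 (-1)^(n+1) q^((n+1)^2) [prod_plus n] and the last summand, q^(n+1) times it, add
   up to the new term of theta times [prod_plus n.+1]. *)
rewrite subr_eq => /eqP H; rewrite big_ord_recr /= H thetaS prod_plusS.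
rewrite {1}/prod_minus [in RHS]/prod_minus !big_geq // mulr1.
rewrite (mulnS n.+1 n.+1) mulnn exprD; ring.
Qed.

End Shanks.

Lemma theta_prod (F : fieldType) n :
  'X^(n.+1) %| theta F n * prod_plus F n - prod_minus F 0 n.
Proof.
rewrite theta_shanks big_ord_recl /= addrAC subrr add0r.
apply: (big_ind (fun p : {poly F} => 'X^(n.+1) %| p)); first exact: dvdp0.
  by move=> p q; apply: dvdp_add.
move=> s _ /=; rewrite -!mulrA dvdp_mull // dvdp_mull // dvdp_mulr //.
by apply: dvdp_exp2l; rewrite mulnC leq_pmulr.
Qed.

(** * Generating functions modulo 7 *)

(** With this the sign of a term in a power of theta depends on its exponent alone. *)
Lemma signr_sqr (R : nzRingType) k : (-1) ^+ (k ^ 2) = (-1) ^+ k :> R.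
Proof. by rewrite -signr_odd oddX signr_odd. Qed.

Lemma theta_exp3 (R : comNzRingType) N :
  theta R N ^+ 3 = \sum_(v <- box3 N) (-1) ^+ norm3 v * 'X^(norm3 v).
Proof.
rewrite /box3 !big_allpairs_dep exprSr expr2 /theta big_distrlr big_distrl.
apply: eq_bigr => x _; rewrite /= big_distrl; apply: eq_bigr => y _ /=.
rewrite big_distrr; apply: eq_bigr => z _; rewrite /norm3 /=.
rewrite !exprD !signr_sqr; ring.
Qed.

Lemma theta_exp4 (R : comNzRingType) N :
  theta R N ^+ 4 = \sum_(v <- box4 N) (-1) ^+ norm4 v * 'X^(norm4 v).
Proof.
rewrite /box4 big_allpairs_dep exprSr theta_exp3 /theta big_distrlr.
apply: eq_bigr => v _; apply: eq_bigr => z _.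
rewrite /norm4 /= !exprD !signr_sqr; ring.
Qed.

Lemma coef_sum_signXn (R : comNzRingType) (T : Type) (s : seq T)
    (f : T -> nat) n :
  (\sum_(v <- s) (-1) ^+ f v * 'X^(f v) : {poly R})`_n =
  (-1) ^+ n * (size [seq v <- s | f v == n])%:R.
Proof.
rewrite coef_sum size_filter -sum1_count natr_sum big_distrr [RHS]big_mkcond /=.
apply: eq_bigr => v _; rewrite -polyC1 -polyCN -polyC_exp coefCM coefXn eq_sym.
by case: eqP => [->|_]; rewrite ?mulr1 ?mulr0.
Qed.

Lemma coef_theta_exp3 (R : comNzRingType) N n : (n <= N)%N ->
  (theta R N ^+ 3)`_n = (-1) ^+ n * (r3 n)%:R.
Proof.
by move=> le_nN; rewrite theta_exp3 coef_sum_signXn -(size_sols3 le_nN).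
Qed.

Lemma coef_theta_exp4 (R : comNzRingType) N n : (n <= N)%N ->
  (theta R N ^+ 4)`_n = (-1) ^+ n * (r4 n)%:R.
Proof.
by move=> le_nN; rewrite theta_exp4 coef_sum_signXn -(size_sols4 le_nN).
Qed.

(** That is, theta^p = theta(q^p); [p] being odd preserves the signs. *)
Lemma theta_Frobenius (R : comNzRingType) p N : odd p -> p \in [pchar R] ->
  theta R N ^+ p = \sum_(x <- box N) (-1) ^+ `|x|%N * 'X^(p * `|x| ^ 2)%N.
Proof.
move=> odd_p; rewrite -pchar_poly => pR.
rewrite -(pFrobenius_autE pR) rmorph_sum; apply: eq_bigr => x _ /=.
rewrite pFrobenius_autE exprMn -!exprM -[in LHS]signr_odd oddM odd_p andbT.
by rewrite signr_odd mulnC.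
Qed.

(** The operator U_d, taking sum a(n) q^n to sum a(dn) q^n. For d > 0 the bound [size p] loses no
    coefficient. *)
Definition decimate (R : nzRingType) d (p : {poly R}) : {poly R} :=
  \poly_(i < size p) p`_(d * i).

Lemma coef_decimate (R : nzRingType) d (p : {poly R}) i : (0 < d)%N ->
  (decimate d p)`_i = p`_(d * i).
Proof.
move=> d_gt0; rewrite coef_poly; case: ltnP => // le_pi.
by rewrite nth_default // (leq_trans le_pi) // leq_pmull.
Qed.

(** theta^p has only exponents divisible by p, so it passes through U_p and comes out as theta. *)
Lemma coef_mul_theta_exp (R : comNzRingType) p N (P : {poly R}) n :
  odd p -> p \in [pchar R] ->
  (P * theta R N ^+ p)`_(p * n) = (decimate p P * theta R N)`_n.
Proof.
move=> odd_p pR; rewrite theta_Frobenius // /theta !big_distrr !coef_sum.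
apply: eq_bigr => x _ /=.
rewrite !(mulrCA _ (_ ^+ _)) -polyC1 -polyCN -polyC_exp.
have p_gt0 : (0 < p)%N by apply: odd_gt0.
rewrite !coefCM !coefMXn coef_decimate // ltn_pmul2l // mulnBr.
by case: ifP.
Qed.

(** * Product formula for the generating function of overpartitions *)

Lemma gf_parts_le0 (R : nzRingType) N : gf R N (parts_le 0) = 1.
Proof.
rewrite /gf -big_filter (perm_big [:: [::]]) ?big_seq1 //=.
apply: uniq_perm => //; first by rewrite filter_uniq ?overpartitions_uniq.
move=> [|[k b] s]; rewrite mem_filter mem_overpartitions inE //=.
rewrite is_overpartition_cons /parts_le /=; by case: k => [|k]; rewrite ?andbF.
Qed.

Lemma gf_parts_le_rec (F : fieldType) N m :
  'X^(N.+1) %| gf F N (parts_le m.+1)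
               - (1 + 'X^(m.+1)) * gf F N (parts_le_nomark m.+1).
Proof.
apply/dvdXnP => i; rewrite ltnS => le_iN.
rewrite coefB mulrDl mul1r coefD coefXnM !coef_gf num_ov_parts_le //.
rewrite natrD ltnS; case: ltnP => _; ring.
Qed.

Lemma gf_parts_le_nomark_rec (F : fieldType) N m :
  'X^(N.+1) %| (1 - 'X^(m.+1)) * gf F N (parts_le_nomark m.+1)
               - gf F N (parts_le m).
Proof.
apply/dvdXnP => i; rewrite ltnS => le_iN.
rewrite coefB mulrBl mul1r coefB coefXnM !coef_gf num_ov_parts_le_nomark //.
rewrite natrD ltnS; case: ltnP => _; ring.
Qed.

Lemma gf_parts_le_prod (F : fieldType) N m :
  'X^(N.+1) %| gf F N (parts_le m) * prod_minus F 0 m - prod_plus F m.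
Proof.
elim: m => [|m IHm].
  by rewrite gf_parts_le0 /prod_minus /prod_plus !big_geq // mulr1 subrr dvdp0.
rewrite prod_minusS // prod_plusS.
have [H1 H2] := (gf_parts_le_rec F N m, gf_parts_le_nomark_rec F N m).
set G := gf F N (parts_le m.+1) in H1 *.
set H := gf F N (parts_le_nomark _) in H1 H2.
set G' := gf F N (parts_le m) in IHm H2.
set A := prod_minus _ _ _ in IHm *; set B := prod_plus _ _ in IHm *.
(* A combination of the two recursions and the induction hypothesis. *)
have -> : G * (A * (1 - 'X^(m.+1))) - B * (1 + 'X^(m.+1)) =
    (G - (1 + 'X^(m.+1)) * H) * (A * (1 - 'X^(m.+1)))
    + ((1 - 'X^(m.+1)) * H - G') * ((1 + 'X^(m.+1)) * A)
    + (G' * A - B) * (1 + 'X^(m.+1)) by ring.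
by rewrite !dvdp_add // dvdp_mulr.
Qed.

Lemma parts_le_weight s : parts_le (weight s) s.
Proof.
rewrite /parts_le /weight; elim: (parts s) => //= k t IHt; rewrite leq_addr /=.
by apply: sub_all IHt => j /leq_trans; apply; apply: leq_addl.
Qed.

Lemma gf_predT (R : nzRingType) N : gf R N predT = gf R N (parts_le N).
Proof.
rewrite /gf big_seq_cond [RHS]big_seq_cond; apply: eq_bigl => s.
rewrite mem_overpartitions andbT.
case: (boolP (_ && _)) => //= /andP[_ le_sN]; symmetry.
by apply: sub_all (parts_le_weight s) => j /leq_trans; apply.
Qed.

Lemma prod_plus_coef0 (R : comNzRingType) n : (prod_plus R n)`_0 = 1.
Proof.
elim: n => [|n IHn]; first by rewrite /prod_plus big_geq ?coef1.
by rewrite prod_plusS coef0M IHn mul1r coefD coef1 coefXn addr0.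
Qed.

(** The product formula for overpartitions and Gauss' identity have reciprocal right-hand sides;
    [prod_plus] is cancelled by its constant term 1. *)
Lemma gf_theta (F : fieldType) N : 'X^(N.+1) %| gf F N predT * theta F N - 1.
Proof.
rewrite gf_predT; have [H1 H2] := (gf_parts_le_prod F N N, theta_prod F N).
apply: (@dvdXn_mulIl _ _ (prod_plus F N)).
  by rewrite prod_plus_coef0 oner_eq0.
have -> : prod_plus F N * (gf F N (parts_le N) * theta F N - 1) =
  gf F N (parts_le N) * (theta F N * prod_plus F N - prod_minus F 0 N)
  + (gf F N (parts_le N) * prod_minus F 0 N - prod_plus F N) by ring.
by rewrite dvdp_add // dvdp_mull.
Qed.

Lemma coef_gf_exp3 (R : comNzRingType) N :
  (gf R N predT ^+ 3)`_N = (pbar3 N)%:R.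
Proof.
pose P (t : bounded_seq N) :=
  is_overpartition (entries t) && (weight (entries t) <= N)%N.
have -> : gf R N predT = \sum_(t | P t) 'X^(weight (entries t)).
  by rewrite /gf big_filter big_map big_enum_cond.
rewrite exprSr expr2 big_distrl.
under eq_bigr do rewrite big_distrr.
rewrite pair_big big_distrl; under eq_bigr do rewrite big_distrr.
rewrite pair_big coef_sum /pbar3 -sum1_card natr_sum big_mkcond [RHS]big_mkcond.
apply: eq_bigr => -[[t1 t2] t3] _ /=; rewrite inE /= -!exprD coefXn /P.
case: (is_overpartition (entries t1)) => //=.
case: (is_overpartition (entries t2)); rewrite ?andbF //=.
case: (is_overpartition (entries t3)); rewrite ?andbF //=.
(* A total weight of [N] bounds each weight by [N], so [P] excludes no triple. *)
rewrite [N == _]eq_sym; case: eqP => [sum_w|_]; last by case: ifP.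
by rewrite ifT //; apply/andP; split; [apply/andP; split|]; lia.
Qed.

(** * The value of pbar3(7n) modulo 7, and the theorem *)

Lemma pbar3_mul7_mod7 n : (pbar3 (7 * n))%:R = (-1) ^+ n * (r3 n)%:R :> 'F_7.
Proof.
have p7 : 7%N \in [pchar 'F_7] by apply: pchar_Fp.
set N := (7 * n)%N; set G := gf 'F_7 N predT; set phi := theta 'F_7 N.
have le_nN : (n <= N)%N by rewrite leq_pmull.
have Gphi : 'X^(N.+1) %| G ^+ 3 * phi ^+ 7 - phi ^+ 4.
  (* Factor u^3 - 1 = (u - 1)(u^2 + u + 1) at u = G phi. *)
  have -> : G ^+ 3 * phi ^+ 7 - phi ^+ 4 =
    (G * phi - 1) * (phi ^+ 4 * ((G * phi) ^+ 2 + G * phi + 1)) by ring.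
  by rewrite dvdp_mulr // gf_theta.
(* Compare the coefficients of index 7i in [Gphi]: U_7 turns the left side into U_7(G^3) phi and
   fixes phi^4 modulo 7, by [r4_mul7]. *)
have : 'X^(n.+1) %| phi * (decimate 7 (G ^+ 3) - phi ^+ 3).
  apply/dvdXnP => i; rewrite ltnS => le_in.
  have le_iN : (7 * i <= N)%N by rewrite leq_pmul2l.
  rewrite mulrBr -exprS mulrC coefB -coef_mul_theta_exp //.
  have/dvdXnP/(_ (7 * i)%N) := Gphi; rewrite ltnS coefB => /(_ le_iN) /eqP.
  rewrite subr_eq0 => /eqP ->; rewrite !coef_theta_exp4 ?(leq_trans le_in) //.
  rewrite -signr_odd oddM /= signr_odd -(Fp_nat_mod _ (r4 (7 * i))) // r4_mul7.
  by rewrite Fp_nat_mod // subrr.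
move/dvdXn_mulIl; rewrite theta_coef0 => /(_ (oner_neq0 _)).
move/dvdXnP/(_ n (ltnSn n)).
rewrite coefB coef_decimate // coef_gf_exp3 coef_theta_exp3 // => /eqP.
by rewrite subr_eq0 => /eqP.
Qed.

Lemma r3_pow4 a n : r3 (4 ^ a * n) = r3 n.
Proof. by elim: a => [|a IHa]; rewrite ?mul1n // expnS -mulnA r3_mul4. Qed.

Lemma eqz_mod_pchar (R : nzRingType) p (a b : int) : p \in [pchar R] ->
  a%:~R = b%:~R :> R -> (a = b %[mod p])%Z.
Proof.
move=> pR ab; apply/eqP.
by rewrite eqz_mod_dvd (dvdz_pcharf pR) rmorphB /= ab subrr.
Qed.

Local Close Scope ring_scope.

Theorem theorem4p3 (alpha n : nat) :
  (((pbar3 (7 * 4 ^ alpha.+1 * n))%N%:Z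
      = (-1) ^+ n * (pbar3 (7 * n))%N%:Z %[mod 7])%Z)%R
  /\ pbar3 (4 ^ alpha * (56 * n + 49)) = 0 %[mod 7].
Proof.
have p7 : 7 \in [pchar 'F_7]%R by apply: pchar_Fp.
split.
  apply: (eqz_mod_pchar (p := 7) p7).
  rewrite rmorphM rmorphXn rmorphN1 /= -!pmulrn.
  (* Both sides become r3(n): the two signs (-1)^n on the right cancel, and on the left the exponent
     is even. *)
  rewrite -mulnA !pbar3_mul7_mod7 r3_pow4 mulrA -expr2 sqrr_sign mul1r.
  by rewrite -signr_odd oddM oddX mul1r.
have -> : (4 ^ alpha * (56 * n + 49) = 7 * (4 ^ alpha * (8 * n + 7)))%N by lia.
apply/eqP; rewrite mod0n -/(7 %| _)%N (dvdn_pcharf p7).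
by rewrite pbar3_mul7_mod7 r3_pow4 r3_8D7 mulr0.
Qed.
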